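(* Let $k_1,k_2,k_3>0$, let $m,n\geq 1$ be integers, and let $\mathbf{u}_1,\dots,\mathbf{u}_n\in\mathbb{C}^m$ satisfy $\|\mathbf{u}_i\|_2^2\leq k_1\frac{m}{n}$ for all $i=1,\dots,n$ and $$k_2\|\mathbf{w}\|_2^2\leq\sum_{i=1}^n|\langle\mathbf{w},\mathbf{u}_i\rangle|^2\leq k_3\|\mathbf{w}\|_2^2\qquad\text{for all }\mathbf{w}\in\mathbb{C}^m .$$ Then there is a set $J\subseteq[n]$ of size $\#J\leq c_1 m$ with $$c_2\cdot\frac{m}{n}\|\mathbf{w}\|_2^2\leq\sum_{i\in J}|\langle\mathbf{w},\mathbf{u}_i\rangle|^2\leq c_3\cdot\frac{m}{n}\|\mathbf{w}\|_2^2\qquad\text{for all }\mathbf{w}\in\mathbb{C}^m,$$ where $c_1,c_2,c_3$ only depend on $k_1,k_2,k_3$. More precisely, one can choose $$c_1=1642\,\frac{k_1}{k_2},\qquad c_2=(2+\sqrt2)^2k_1,\qquad c_3=1642\,\frac{k_1k_3}{k_2}$$ in case $\frac{n}{m}\geq 47\frac{k_1}{k_2}$; and in the regime $1\leq\frac{n}{m}<47\frac{k_1}{k_2}$ one may put $$c_1=47\,\frac{k_1}{k_2},\qquad c_2=k_2,\qquad c_3=47\,\frac{k_1k_3}{k_2}.$$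
   Context: $[n]=\{1,\dots,n\}$; $\langle\cdot,\cdot\rangle$ and $\|\cdot\|_2$ are the standard inner product and Euclidean norm on $\mathbb{C}^m$; $\#J$ is the cardinality of $J$. *)

(* Defs.v *)
(* C^m is 'rV[R[i]]_m for a realType R, with the standard inner
   product dotmx u v = \sum_j u_j * conj v_j, linear in the first argument. *)
From mathcomp Require Export all_boot all_order all_algebra.
From mathcomp Require Export sesquilinear spectral.
From mathcomp Require Export reals complex.

Set Implicit Arguments.
Unset Strict Implicit.
Unset Printing Implicit Defensive.

Import Order.TTheory GRing.Theory Num.Theory.
Local Open Scope ring_scope.
Local Open Scope complex_scope.

Notation "''[' u , v ]" := (dotmx u v) : ring_scope.

Definition l2norm (R : realType) (m : nat) (w : 'rV[R[i]]_m) : R[i] :=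
  sqrtC '[w, w].

(* The inequalities are in R[i], where x <= y means that y - x is a nonnegative
   real; all the quantities compared below are real. *)
Definition frame_bounds (R : realType) (m n : nat) (u : 'I_n -> 'rV[R[i]]_m)
    (J : {set 'I_n}) (a b : R) : Prop :=
  forall w : 'rV[R[i]]_m,
    a%:C * l2norm w ^+ 2 <= \sum_(i in J) `|'[w, u i]| ^+ 2
                         <= b%:C * l2norm w ^+ 2.

Definition has_small_subframe (R : realType) (m n : nat)
    (u : 'I_n -> 'rV[R[i]]_m) (c1 c2 c3 : R) : Prop :=
  exists J : {set 'I_n},
    #|J|%:R <= c1 * m%:R /\
    frame_bounds u J (c2 * (m%:R / n%:R)) (c3 * (m%:R / n%:R)).

(* Main.v *)
(* The set is found by repeatedly halving the frame.  A halving that keeps the frame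
   operator A_J of the current set J within a factor 1/2 + O((eps / alpha)^(1/2)),
   where eps bounds the squared norms and alpha is the lower frame bound, is a case of the
   theorem of Marcus, Spielman and Srivastava.  For signs attached to the vectors of J,
   giving S and its complement, the polynomial D(z) D(y), with
   D(z) = det (sum_(i in J) z_i u_i^* u_i), is multiaffine and nonzero when all the
   imaginary parts are positive.  A choice of sign at i lowers z_i or y_i by 2, and the
   average of the two is 1 - d/dz_i - d/dy_i.  This operator preserves stability, and the
   barriers (d/dz_i) log, (d/dy_i) log control how far the region above the roots moves.
   Stability enters only through the Rayleigh inequalities f * f_ij <= f_i * f_j at real
   points: they make the barriers nonincreasing, and convex along e_(z_i) + e_(y_i).
   The monotonicity also lets one fix the signs one at a time, which replaces the usual
   interlacing argument.  The relative errors of the successive halvings form a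
   geometric series dominated by the last one, so the bounds remain comparable. *)
Require Import Defs.
From mathcomp Require Import all_boot all_order all_algebra.
From mathcomp Require Import sesquilinear spectral reals complex.
From mathcomp Require Import ring lra.

Set Implicit Arguments.
Unset Strict Implicit.
Unset Printing Implicit Defensive.

Import Order.TTheory GRing.Theory Num.Theory.
Local Open Scope ring_scope.
Local Open Scope complex_scope.

(** * Multiaffine functions and real barriers *)

Section Multiaffine.
Variables (K : comNzRingType) (I : finType).
Implicit Types (z : {ffun I -> K}) (f : {ffun I -> K} -> K).

Definition shift z i (s : K) : {ffun I -> K} := [ffun j => z j + s *+ (j == i)].

Definition diff f i z := f (shift z i 1) - f z.

(** Affine in each variable, with the unit difference as slope. Hence [diff f i] is the partial
    derivative in the variable [i], over any commutative ring. *)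
Definition multiaffine f := forall z i s, f (shift z i s) = f z + s * diff f i z.

(* [1 - d_a - d_b], the derivatives of a multiaffine function being differences *)
Definition subdiff2 f a b z := f z - diff f a z - diff f b z.

Lemma shiftC z i j s t : shift (shift z i s) j t = shift (shift z j t) i s.
Proof. by apply/ffunP => k; rewrite !ffunE addrAC. Qed.

Lemma shiftD z i s t : shift (shift z i s) i t = shift z i (s + t).
Proof. by apply/ffunP => k; rewrite !ffunE mulrnDl addrA. Qed.

Lemma diffC f i j z : diff (diff f i) j z = diff (diff f j) i z.
Proof. by rewrite /diff shiftC; ring. Qed.

Lemma multiaffine_diff f i : multiaffine f -> multiaffine (diff f i).
Proof.
move=> fM z j s; rewrite /diff (shiftC z j i s) (shiftC z j i 1).
by rewrite (fM (shift z i 1) j s) (fM z j s) /diff; ring.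
Qed.

Lemma diff_diag f i z : multiaffine f -> diff (diff f i) i z = 0.
Proof.
by move=> fM; rewrite /diff shiftD (fM z i (1 + 1)) /diff; ring.
Qed.

Lemma multiaffine_subdiff2 f a b : multiaffine f -> multiaffine (subdiff2 f a b).
Proof.
move=> fM z i s; rewrite /diff /subdiff2 !fM.
rewrite !(multiaffine_diff _ fM) /=; ring.
Qed.

Lemma diff_subdiff2 f a b i z :
  diff (subdiff2 f a b) i z =
  diff f i z - diff (diff f i) a z - diff (diff f i) b z.
Proof.
rewrite [diff (diff f i) a z]diffC [diff (diff f i) b z]diffC.
by rewrite /diff /subdiff2 /diff; ring.
Qed.

Definition shift2 z a b s := shift (shift z a s) b s.

Lemma multiaffine_shift2 f z a b s : multiaffine f ->
  f (shift2 z a b s) = f z + s * (diff f a z + diff f b z) +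
    s ^+ 2 * diff (diff f a) b z.
Proof.
by move=> fM; rewrite /shift2 !fM (multiaffine_diff b fM) [diff (diff f b) a z]diffC; ring.
Qed.

Lemma diff_diff_diag f a b z : multiaffine f -> diff (diff (diff f a) a) b z = 0.
Proof. by move=> fM; rewrite {1}/diff !diff_diag // subrr. Qed.

Lemma diff_shift2 f z a b s : multiaffine f ->
  diff f a (shift2 z a b s) + diff f b (shift2 z a b s) =
  diff f a z + diff f b z + diff (diff f a) b z *+ 2 * s.
Proof.
move=> fM; rewrite !multiaffine_shift2; [|exact: multiaffine_diff..].
rewrite diff_diff_diag // !diff_diag // [diff (diff f b) a z]diffC.
have -> : diff (diff (diff f b) a) b z = 0.
  transitivity (diff (diff (diff f b) b) a z); last exact: diff_diff_diag.
  exact: diffC.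
ring.
Qed.

End Multiaffine.

Section Barrier.
Variables (R : realFieldType) (I : finType).
Implicit Types (x y : {ffun I -> R}) (f : {ffun I -> R} -> R).

(** The second clause says that the barrier [diff f i / f] has nonpositive derivative in the
    variable [j] wherever [f] does not vanish. *)
Definition rayleigh f := multiaffine f /\
  forall i j x, diff (diff f i) j x * f x <= diff f i x * diff f j x.

Definition le_pt x y := forall i, x i <= y i.

(** The analogue in several variables of lying beyond the largest root. *)
Definition above f x := forall y, le_pt x y -> 0 < f y.

Lemma le_pt_refl x : le_pt x x. Proof. by move=> i. Qed.

Lemma le_pt_trans y x z : le_pt x y -> le_pt y z -> le_pt x z.
Proof. by move=> xy yz i; apply: le_trans (xy i) (yz i). Qed.

Lemma le_pt_shift x i (s : R) : 0 <= s -> le_pt x (shift x i s).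
Proof. by move=> s0 j; rewrite ffunE lerDl mulrn_wge0. Qed.

Lemma above_le f x y : le_pt x y -> above f x -> above f y.
Proof. by move=> xy fx z yz; apply: fx; apply: le_pt_trans yz. Qed.

Lemma rayleigh_shift_le f x c d (r : R) : rayleigh f -> 0 <= r ->
  diff f c (shift x d r) * f x <= diff f c x * f (shift x d r).
Proof.
move=> [fM fR] r0; rewrite fM (multiaffine_diff c fM).
have := ler_wpM2l r0 (fR c d x); lra.
Qed.

(** The passage from [x] to [y] changes one coordinate at a time, each change being an instance of
    [rayleigh_shift_le]. The list [s] holds the coordinates in which the two points may still
    differ. *)
Lemma barrier_antitone f x y c : rayleigh f -> above f x -> le_pt x y ->
  diff f c y / f y <= diff f c x / f x.
Proof.
move=> fR fx xy.
suff H (s : seq I) : forall y, le_pt x y -> (forall i, i \notin s -> y i = x i) ->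
    diff f c y / f y <= diff f c x / f x.
  by apply: (H (enum I)) => // i; rewrite mem_enum.
elim: s => [|k s IH] {xy}y xy ys.
  by have -> : y = x by apply/ffunP => i; apply: ys.
pose y' := shift y k (x k - y k).
have xy' : le_pt x y'.
  by move=> i; rewrite ffunE; have [->|_] := eqVneq i k;
    rewrite ?mulr1n ?addr0 ?xy // addrC subrK.
have yE : y = shift y' k (y k - x k).
  by rewrite shiftD (_ : _ + _ = 0); [apply/ffunP => i; rewrite ffunE mul0rn addr0|ring].
have y'y : le_pt y' y by rewrite yE; apply: le_pt_shift; rewrite subr_ge0.
apply: le_trans (IH y' xy' _); last first.
  move=> i; rewrite ffunE; have [->|ik is_] := eqVneq i k; first by rewrite addrC subrK.
  by rewrite addr0 ys // inE negb_or ik.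
have fy' : 0 < f y' by apply: fx.
have fy : 0 < f y by apply: fx.
rewrite (ler_pdivrMr _ _ fy) [leRHS]mulrAC (ler_pdivlMr _ _ fy') yE.
by apply: rayleigh_shift_le; rewrite ?subr_ge0.
Qed.

Lemma slope_ge0 (p q : R) : (forall r, 0 <= r -> 0 <= p + r * q) -> 0 <= q.
Proof.
move=> H; rewrite leNgt; apply/negP => q0.
have p0 : 0 <= p by have := H 0 (lexx 0); rewrite mul0r addr0.
(* At this [r] the affine function takes the value -1. *)
have r0 : 0 <= (p + 1) / - q by rewrite divr_ge0 ?addr_ge0 // oppr_ge0 ltW.
have := H _ r0; rewrite -mulrA [_^-1 * q]mulrC invrN mulrN divff ?lt_eqF //.
lra.
Qed.

Lemma above_diff_ge0 f x i : multiaffine f -> above f x -> 0 <= diff f i x.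
Proof.
move=> fM fx; apply: (@slope_ge0 (f x)) => r r0.
by rewrite -fM; apply/ltW/fx/le_pt_shift.
Qed.

Lemma above_diff2_ge0 f x i j : multiaffine f -> above f x ->
  0 <= diff (diff f i) j x.
Proof.
move=> fM fx; apply: (@slope_ge0 (diff f i x)) => r r0.
rewrite -(multiaffine_diff i fM); apply: above_diff_ge0 => //.
by apply: above_le fx; apply: le_pt_shift.
Qed.

Lemma disc_le0 (a b c : R) :
  (forall r, a + b *+ 2 * r + c * r ^+ 2 <= 0) -> b ^+ 2 <= a * c.
Proof.
move=> H; have a0 : a <= 0 by have := H 0; rewrite mulr0 expr0n mulr0 !addr0.
have c0 : c <= 0.
  rewrite leNgt; apply/negP => c0.
  (* For positive [c] this point is far enough to the right for the quadratic to be positive. *)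
  have := H ((`|b| *+ 2 - a + c) / c).
  have := normr_ge0 b; have := ler_norm (-b); rewrite normrN.
  set n := `|b|; move=> nb n0.
  have -> : c * ((n *+ 2 - a + c) / c) ^+ 2 = (n *+ 2 - a + c) ^+2 / c.
    by field; rewrite gt_eqF.
  have -> : b *+ 2 * ((n *+ 2 - a + c) / c) = b *+2 * (n *+ 2 - a + c) / c by ring.
  rewrite -[X in X + _ + _](mulfK (lt0r_neq0 c0)) -!mulrDl pmulr_lle0 ?invr_gt0 //.
  set t := n *+ 2 - a + c => H'.
  have t0 : 0 <= t by rewrite /t; lra.
  have h1 : 0 <= (b + n) * t by rewrite mulr_ge0 //; lra.
  have h2 : 0 <= n * (c - a) by rewrite mulr_ge0 //; lra.
  have h3 : 0 <= - a * c by rewrite mulr_ge0 //; lra.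
  have h4 : 0 < c ^+ 2 by rewrite exprn_gt0.
  have h5 := sqr_ge0 a.
  have : t * t = t * (n *+ 2) + (n *+ 2 - a + c) * (c - a) by rewrite /t; ring.
  lra.
have [c_eq0|c_neq0] := eqVneq c 0.
  suff -> : b = 0 by rewrite c_eq0 mulr0 expr0n.
  apply/eqP; apply: contraT => b0.
  have := H ((1 - a) / (b *+ 2)).
  rewrite c_eq0 mul0r addr0 mulrC divfK ?mulrn_eq0 //; lra.
have := H (- b / c).
have -> : a + b *+ 2 * (- b / c) + c * (- b / c) ^+ 2 = (a * c - b ^+ 2) / c by field.
rewrite ler_ndivrMr ?mul0r; first lra.
by rewrite lt_neqAle c_neq0.
Qed.

(* [(n / q)(0) >= (n / q)(s) - s (n / q)'(s)] cleared of denominators, where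
   [w = q ^ 2 (n / q)']. *)
Lemma quadratic_tangent (n0 n1 n2 q0 q1 q2 s : R) :
  let n r := n0 + n1 * r + n2 * r ^+ 2 in
  let q r := q0 + q1 * r + q2 * r ^+ 2 in
  let w r := (n1 + n2 *+ 2 * r) * q r - n r * (q1 + q2 *+ 2 * r) in
  0 < q0 -> 0 <= q1 -> 0 <= q2 -> 0 <= s -> (forall r, w r <= 0) ->
  (n s * q s - s * w s) * q0 <= n0 * q s ^+ 2.
Proof.
move=> n q w q0_gt0 q1_ge0 q2_ge0 s0 wle.
(* These are the 2 by 2 minors of the coefficients of [n] and [q]; up to sign and a factor 2 they
   are the coefficients of [w], whose constant sign bounds its discriminant. *)
pose a := n0 * q1 - n1 * q0; pose b := n2 * q0 - n0 * q2; pose c := n1 * q2 - n2 * q1.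
have wE r : w r = - a + b *+ 2 * r - c * r ^+ 2 by rewrite /w /n /q /a /b /c; ring.
have abc : b ^+ 2 <= a * c.
  rewrite -mulrNN; apply: disc_le0 => r; have := wle r; rewrite wE; lra.
have a0 : 0 <= a by have := wle 0; rewrite wE; lra.
(* The linear relation between the three minors eliminates [c] from the discriminant inequality. *)
have rel : q0 * c = - (q2 * a + q1 * b) by rewrite /a /b /c; ring.
have cross : q0 * b ^+ 2 + a * (q1 * b) + q2 * a ^+ 2 <= 0.
  have := ler_wpM2l (ltW q0_gt0) abc; rewrite (mulrCA q0 a) rel; lra.
have ident : n0 * q s ^+ 2 - (n s * q s - s * w s) * q0 =
    s ^+ 2 * (a * q1 + b * q0 + 2 * (a * q2 * s) + - b * q2 * s ^+ 2).
  rewrite /w /n /q /a /b; ring.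
have b_le0 : b <= 0.
  rewrite leNgt; apply/negP => b0.
  have h1 : 0 < q0 * b ^+ 2 by rewrite mulr_gt0 // exprn_gt0.
  have h2 : 0 <= a * (q1 * b) by rewrite !mulr_ge0 // ltW.
  have h3 : 0 <= q2 * a ^+ 2 by rewrite mulr_ge0 // sqr_ge0.
  lra.
have key : 0 <= a * q1 + b * q0.
  have [->|b_neq0] := eqVneq b 0; first by rewrite mul0r addr0 mulr_ge0.
  have b_lt0 : b < 0 by rewrite lt_neqAle b_neq0.
  (* [cross] reads b (a q1 + b q0) + q2 a^2 <= 0, so the bracket times the negative [b] is
     nonpositive. *)
  rewrite -(nmulr_lle0 _ b_lt0).
  have : 0 <= q2 * a ^+ 2 by rewrite mulr_ge0 // sqr_ge0.
  lra.
rewrite -subr_ge0 ident mulr_ge0 ?sqr_ge0 //; apply: addr_ge0; last first.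
  by rewrite !mulr_ge0 ?sqr_ge0 ?oppr_ge0.
by apply: addr_ge0 => //; rewrite !mulr_ge0.
Qed.

Lemma subdiff2E f a b x : f x != 0 ->
  subdiff2 f a b x = f x * (1 - diff f a x / f x - diff f b x / f x).
Proof. by move=> fx; rewrite /subdiff2; field. Qed.

(** The quotient of [subdiff2 f a b] by [f] is 1 minus two barriers. These decrease upwards, so the
    lower bound 1/s for the quotient at [x] persists at every [y] above [x]. *)
Lemma above_subdiff2 f x a b (s : R) : rayleigh f -> above f x -> 0 <= s ->
  f x <= s * subdiff2 f a b x ->
  forall y, le_pt x y -> 0 < subdiff2 f a b y /\ f y <= s * subdiff2 f a b y.
Proof.
move=> fR fx s0 fxs y xy.
have fx0 : 0 < f x by apply: fx.
have fy0 : 0 < f y by apply: fx.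
have ha := barrier_antitone a fR fx xy; have hb := barrier_antitone b fR fx xy.
move: fxs; rewrite !subdiff2E ?gt_eqF //; set A := 1 - _ - _; set B := 1 - _ - _.
have AB : A <= B by rewrite /A /B; lra.
rewrite mulrCA -[leLHS]mulr1 ler_pM2l // => sA.
have sB : 1 <= s * B by apply: le_trans sA _; rewrite ler_wpM2l.
split; last by rewrite mulrCA -[leLHS]mulr1 ler_pM2l.
rewrite mulr_gt0 // lt_neqAle eq_sym.
have B0 : 0 <= B by rewrite leNgt; apply/negP => B0; have := mulr_ge0_le0 s0 (ltW B0); lra.
rewrite B0 andbT; apply/eqP => B_eq0; move: sB; rewrite B_eq0 mulr0; lra.
Qed.

(** Applying 1 - d_a - d_b raises a barrier, and the shift by [s] in both directions makes up for
    it: the tangent inequality of [quadratic_tangent] bounds the gain from below by [s] times the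
    slope at [y], and the bound [sGy] shows that this is enough. *)
Lemma barrier_step f x a b c (s : R) : rayleigh f -> above f x -> 0 <= s ->
  f x <= s * subdiff2 f a b x ->
  diff (subdiff2 f a b) c (shift2 x a b s) / subdiff2 f a b (shift2 x a b s)
    <= diff f c x / f x.
Proof.
move=> fR fx s0 fxs; have [fM fD] := fR.
have fcM := multiaffine_diff c fM.
set y := shift2 x a b s.
have xy : le_pt x y by apply: le_pt_trans (le_pt_shift _ _ s0); apply: le_pt_shift.
have [Gy sGy] := above_subdiff2 fR fx s0 fxs xy.
have fx0 : 0 < f x by apply: fx.
have fy0 : 0 < f y by apply: fx.
(* This is f^2 times the derivative of the barrier in direction [c] along e_a + e_b. *)
pose w z := (diff (diff f c) a z + diff (diff f c) b z) * f z -
  diff f c z * (diff f a z + diff f b z).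
have w_le0 z : w z <= 0 by have := fD c a z; have := fD c b z; rewrite /w; lra.
have tangent : (diff f c y * f y - s * w y) * f x <= diff f c x * f y ^+ 2.
  have qE r : f (shift2 x a b r) = f x + (diff f a x + diff f b x) * r +
      diff (diff f a) b x * r ^+ 2.
    by rewrite multiaffine_shift2 //; ring.
  have nE r : diff f c (shift2 x a b r) = diff f c x +
      (diff (diff f c) a x + diff (diff f c) b x) * r +
      diff (diff (diff f c) a) b x * r ^+ 2.
    by rewrite multiaffine_shift2 //; ring.
  have := @quadratic_tangent (diff f c x)
    (diff (diff f c) a x + diff (diff f c) b x) (diff (diff (diff f c) a) b x)
    (f x) (diff f a x + diff f b x) (diff (diff f a) b x) s.
  rewrite /= -nE -qE -!diff_shift2 //; apply => //.
  - by rewrite addr_ge0 // above_diff_ge0.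
  - by rewrite above_diff2_ge0.
  - by move=> r; rewrite -nE -qE -!diff_shift2 //; exact: w_le0.
rewrite ler_pdivrMr // [leRHS]mulrAC ler_pdivlMr //.
rewrite diff_subdiff2.
have fy2 : 0 < f y ^+ 2 by rewrite exprn_gt0.
rewrite -(ler_pM2r fy2).
have h1 := ler_wpM2r (ltW Gy) tangent.
have h2 : 0 <= (- w y) * (s * subdiff2 f a b y - f y) * f x.
  by rewrite !mulr_ge0 ?oppr_ge0 ?subr_ge0 // ltW.
rewrite -subr_ge0.
have -> : diff f c x * subdiff2 f a b y * f y ^+ 2 -
  (diff f c y - diff (diff f c) a y - diff (diff f c) b y) * f x * f y ^+ 2 =
  (diff f c x * f y ^+ 2 * subdiff2 f a b y -
   (diff f c y * f y - s * w y) * f x * subdiff2 f a b y) + 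
  (- w y) * (s * subdiff2 f a b y - f y) * f x
  by rewrite /w /subdiff2; ring.
by rewrite addr_ge0 // subr_ge0.
Qed.

(* Along [u = e_a + e_b], [f] is quadratic and [g = f - D_u f], so that
   [f = g + D_u g + D_u D_u g] is the mean of [g] at the points [y] and [y + 2 u]. *)
Lemma above_of_subdiff2 f x a b : multiaffine f ->
  above (subdiff2 f a b) x -> above f x.
Proof.
move=> fM gx y xy.
have xy2 : le_pt x (shift2 y a b 2).
  apply: le_pt_trans xy _; apply: le_pt_trans (le_pt_shift _ _ (ler0n _ 2)).
  exact: le_pt_shift.
have := gx _ xy; have := gx _ xy2.
rewrite /subdiff2 -!addrA -!opprD diff_shift2 // multiaffine_shift2 //; lra.
Qed.

(** Since f - f_a - f_b > 0 at [x], one of the two derivatives is below f/2, that is, one barrier is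
    below 1/2. It stays so above [x], where f - 2 f_c is the value of [f] after lowering coordinate
    [c] by 2. *)
Lemma above_choice f x a b : rayleigh f -> above (subdiff2 f a b) x ->
  exists c, (c = a \/ c = b) /\ above f (shift x c (- 2)).
Proof.
move=> fR gx; have fx := above_of_subdiff2 fR.1 gx.
have fx0 := fx x (le_pt_refl x).
have [c cab hc] : exists2 c, c = a \/ c = b & diff f c x *+ 2 < f x.
  have := gx x (le_pt_refl x); rewrite /subdiff2.
  have [h _|h] := ltP (diff f a x *+ 2) (f x); first by exists a; [left|].
  by exists b; [right|lra].
exists c; split => // y xy; rewrite (_ : y = shift (shift y c 2) c (- 2)); last first.
  by rewrite shiftD subrr; apply/ffunP => i; rewrite ffunE mul0rn addr0.
have xy' : le_pt x (shift y c 2).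
  by move=> i; have := xy i; rewrite !ffunE mulNrn lerBlDr.
have fy0 := fx _ xy'.
have := barrier_antitone c fR fx xy'.
have : diff f c x / f x *+ 2 < 1 by rewrite -mulrnAl ltr_pdivrMr // mul1r.
move=> h1 h2; have : diff f c (shift y c 2) / f (shift y c 2) *+ 2 < 1 by lra.
rewrite -mulrnAl ltr_pdivrMr // mul1r (fR.1 (shift y c 2)); lra.
Qed.

End Barrier.

(** * Choices along a stable function *)

Section IteratedBarrier.
Variables (R : realFieldType) (I J : finType) (a b : J -> I).
Implicit Types (x y : {ffun I -> R}) (f : {ffun I -> R} -> R) (ps : seq J).

Definition subdiffs (K : comNzRingType) (f : {ffun I -> K} -> K) ps :=
  foldr (fun j g => subdiff2 g (a j) (b j)) f ps.

(** The induction also carries that no barrier exceeds its value at [x]; thus the condition imposed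
    at [x] for each [j] is still available when the operator of [j] is applied. *)
Lemma above_subdiffs f x (s : R) ps :
  (forall qs, rayleigh (subdiffs f qs)) -> above f x -> 0 <= s ->
  (forall j, f x <= s * subdiff2 f (a j) (b j) x) ->
  above (subdiffs f ps) (foldr (fun j y => shift2 y (a j) (b j) s) x ps).
Proof.
move=> fR fx s0 fxs; have fx0 : 0 < f x by apply: fx.
set X := foldr _ x; suff [] : above (subdiffs f ps) (X ps) /\
  forall c, diff (subdiffs f ps) c (X ps) / subdiffs f ps (X ps) <= diff f c x / f x by [].
elim: ps => [|j ps [IH IHd]] //=.
set g := subdiffs f ps in IH IHd *; set y := X ps in IH IHd *.
have gR : rayleigh g by apply: fR.
have gy0 : 0 < g y by apply: IH.
have gys : g y <= s * subdiff2 g (a j) (b j) y.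
  have := fxs j.
  rewrite !subdiff2E ?gt_eqF // mulrCA -[leLHS]mulr1 ler_pM2l // => h1.
  rewrite mulrCA -[leLHS]mulr1 ler_pM2l //; apply: le_trans h1 _.
  rewrite ler_wpM2l //; have := IHd (a j); have := IHd (b j); lra.
split.
  move=> z yz; have yz' : le_pt y z.
    apply: le_pt_trans yz; apply: le_pt_trans (le_pt_shift _ _ s0).
    exact: le_pt_shift.
  by have [] := above_subdiff2 gR IH s0 gys yz'.
move=> c; apply: le_trans (IHd c); exact: barrier_step.
Qed.

(** The operators are peeled off from the outermost inwards, each being traded for a drop by 2 in
    one of its two coordinates. *)
Lemma above_choices f y ps : uniq ps ->
  (forall qs, rayleigh (subdiffs f qs)) -> above (subdiffs f ps) y ->
  exists sigma : J -> bool, above f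
    [ffun i => y i - 2 * \sum_(j <- ps) ((if sigma j then a j else b j) == i)%:R].
Proof.
move=> ps_uniq fR; elim: ps y ps_uniq => [|j ps IH] y /=.
  move=> _ fy; exists xpredT; rewrite (_ : [ffun _ => _] = y) //.
  by apply/ffunP => i; rewrite ffunE big_nil mulr0 subr0.
move=> /andP[jps ps_uniq] /(above_choice (fR ps))[c [cab]] /(IH _ ps_uniq)[sigma H].
exists (fun k => if k == j then c == a j else sigma k).
move: H; congr (above f _); apply/ffunP => i; rewrite !ffunE big_cons eqxx.
have -> : \sum_(k <- ps) ((if if k == j then c == a j else sigma k then a k else b k) == i)%:R
    = \sum_(k <- ps) ((if sigma k then a k else b k) == i)%:R :> R.
  by apply: eq_big_seq => k kps; have [kj|//] := eqVneq k j; rewrite -kj kps in jps.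
have -> : (if c == a j then a j else b j) = c.
  by case: cab => ->; rewrite ?eqxx //; case: eqP.
by rewrite (eq_sym i); case: (c == i); rewrite ?mulr1n ?mulr0n; ring.
Qed.

Lemma foldr_shift2E x (s : R) ps i :
  foldr (fun j y => shift2 y (a j) (b j) s) x ps i =
  x i + s * \sum_(j <- ps) ((a j == i)%:R + (b j == i)%:R).
Proof.
elim: ps => [|j ps IH]; first by rewrite big_nil mulr0 addr0.
by rewrite /= /shift2 !ffunE IH big_cons !(eq_sym i); case: (a j == i); case: (b j == i); ring.
Qed.

End IteratedBarrier.

(** * Stable functions and their Rayleigh inequalities *)

Section Stable.
Variables (R : rcfType) (I : finType).
Local Notation C := R[i].
Local Notation Re := (@complex.Re R).
Local Notation Im := (@complex.Im R).
Implicit Types (z : {ffun I -> C}) (F : {ffun I -> C} -> C).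

(** The second clause expresses that the coefficients are real, the third that there is no zero in
    the product of open upper half-planes. *)
Definition stable F := [/\ multiaffine F,
  forall z, F [ffun i => conjc (z i)] = conjc (F z) &
  forall z, (forall i, 0 < Im (z i)) -> F z != 0].

Lemma complex_ReD (x y : C) : Re (x + y) = Re x + Re y.
Proof. by case: x y => [x1 x2] [y1 y2]. Qed.

Lemma complex_ImD (x y : C) : Im (x + y) = Im x + Im y.
Proof. by case: x y => [x1 x2] [y1 y2]. Qed.

Lemma complex_ReB (x y : C) : Re (x - y) = Re x - Re y.
Proof. by case: x y => [x1 x2] [y1 y2]. Qed.

Lemma complex_ImM (x y : C) : Im (x * y) = Re x * Im y + Im x * Re y.
Proof. by case: x y => [x1 x2] [y1 y2]. Qed.

Lemma complex_ReM (x y : C) : Re (x * y) = Re x * Re y - Im x * Im y.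
Proof. by case: x y => [x1 x2] [y1 y2]. Qed.

(** Moving coordinate [i] by [t = - F z / d] reaches a zero, so [t] must point into the lower
    half-plane; and Im (d conj(F z)) equals |d|^2 Im t. *)
Lemma stable_diff F z i : stable F -> (forall j, 0 < Im (z j)) ->
  diff F i z = 0 \/ Im (diff F i z * conjc (F z)) < 0.
Proof.
move=> [FM _ Fnz] z_gt0; set d := diff F i z.
have [->|d0] := eqVneq d 0; [by left|right].
pose t := - (F z / d).
have Fz : F z = - (t * d) by rewrite /t mulNr opprK divfK.
have Ft : F (shift z i t) = 0 by rewrite FM -/d Fz addNr.
have t_lt0 : Im t < 0.
  rewrite ltNge; apply/negP => t0.
  suff /Fnz : forall j, 0 < Im (shift z i t j) by rewrite Ft eqxx.
  move=> j; rewrite ffunE complex_ImD /=; have [_|_] := eqVneq j i.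
    by rewrite mulr1n ltr_pwDl.
  by rewrite mulr0n addr0.
rewrite Fz; case: (d) d0 => d1 d2 d0; case: (t) t_lt0 => t1 t2 /= t_lt0.
have -> : d1 * - - (t1 * d2 + t2 * d1) + d2 * - (t1 * d1 - t2 * d2) =
    (d1 ^+ 2 + d2 ^+ 2) * t2 by ring.
rewrite nmulr_llt0 // lt_neqAle eq_sym addr_ge0 ?sqr_ge0 // andbT.
by rewrite paddr_eq0 ?sqr_ge0 // !sqrf_eq0; rewrite eq_complex in d0.
Qed.

(** At a zero, F = F_a + F_b. Multiplied by conj(F), the left side is real, while by [stable_diff]
    the right side has negative imaginary part unless both derivatives vanish, and then F = 0. *)
Lemma stable_subdiff2 F a b : stable F -> stable (subdiff2 F a b).
Proof.
move=> Fs; have [FM FJ Fnz] := Fs; split; first exact: multiaffine_subdiff2.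
  move=> z; rewrite /subdiff2 /diff.
  have E i : shift [ffun i => conjc (z i)] i 1 = [ffun j => conjc (shift z i 1 j)].
    by apply/ffunP => j; rewrite !ffunE rmorphD /= rmorphMn rmorph1.
  by rewrite !E !FJ !rmorphB.
move=> z z_gt0; apply/eqP => G0.
have F0 := Fnz z z_gt0.
have FE : F z = diff F a z + diff F b z.
  by apply/eqP; rewrite -subr_eq0 opprD addrA -/(subdiff2 F a b z) G0.
have Im0 : Im (F z * conjc (F z)) = 0.
  by case: (F z) => x y /=; ring.
move: Im0; rewrite {1}FE mulrDl complex_ImD /=.
have [a0|a0] := stable_diff a Fs z_gt0; have [b0|b0] := stable_diff b Fs z_gt0.
- by move: F0; rewrite FE a0 b0 addr0 eqxx.
- by rewrite a0 mul0r /= add0r => /eqP; rewrite lt_eqF.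
- by rewrite b0 mul0r /= addr0 => /eqP; rewrite lt_eqF.
- by move=> /eqP; rewrite lt_eqF // ltr_nwDr // ltW.
Qed.

Lemma quadratic_limit_le0 (p q r : R) :
  (forall k, 0 < k -> p + q * k + r * k ^+ 2 <= 0) -> p <= 0.
Proof.
move=> H; rewrite leNgt; apply/negP => p0.
(* With [k = p / n], which is at most 1, the quadratic is at least p - (n - p) k = p k > 0. *)
pose n := `|q| + `|r| + p.
have n0 : 0 < n by rewrite ltr_wpDl // addr_ge0.
have k0 : 0 < p / n by rewrite divr_gt0.
have := H _ k0; set k := p / n.
have kn : k * n = p by rewrite /k divfK // gt_eqF.
have k1 : k <= 1 by rewrite /k ler_pdivrMr // mul1r /n lerDr addr_ge0.
have hq : - (`|q| * k) <= q * k.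
  by rewrite -mulNr ler_pM2r // lerNl -normrN ler_norm.
have hr : - (`|r| * k) <= r * k ^+ 2.
  apply: (@le_trans _ _ (- (`|r| * k ^+ 2))).
    rewrite lerN2 ler_wpM2l // expr2 ler_piMr // ltW //.
  by rewrite -mulNr ler_wpM2r ?sqr_ge0 // lerNl -normrN ler_norm.
have : 0 < p * k by rewrite mulr_gt0.
move: kn; rewrite /n; lra.
Qed.

(** Limit case of [stable_diff]: coordinates are pushed into the open half-plane one at a time by
    [t *i]. The imaginary part is then a quadratic in [t], whose constant term is the value
    sought. *)
Lemma stable_diff_closed F z i : stable F -> (forall j, 0 <= Im (z j)) ->
  Im (diff F i z * conjc (F z)) <= 0.
Proof.
move=> Fs z_ge0; have [FM _ _] := Fs.
suff H (s : seq I) : forall z, (forall j, 0 <= Im (z j)) ->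
    (forall j, j \notin s -> 0 < Im (z j)) -> Im (diff F i z * conjc (F z)) <= 0.
  by apply: (H (enum I)) => // j; rewrite mem_enum.
elim: s => [|k s IH] {z_ge0}z z_ge0 zs.
  have z_gt0 j : 0 < Im (z j) by apply: zs.
  by have [->|/ltW//] := stable_diff i Fs z_gt0; rewrite mul0r.
set A := diff F i z; set A' := diff (diff F i) k z; set B := F z; set B' := diff F k z.
apply: (@quadratic_limit_le0 _ (Re A' * Re B + Im A' * Im B - Re A * Re B' - Im A * Im B')
   (Im (A' * conjc B'))) => t t0.
have := IH (shift z k (t *i)).
rewrite FM (multiaffine_diff i FM) -/A -/A' -/B -/B'.
move=> H; apply: le_trans (H _ _).
- case: (A) (A') (B) (B') => [A1 A2] [A3 A4] [B1 B2] [B3 B4] /=.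
  by rewrite le_eqVlt; apply/orP; left; apply/eqP; ring.
- move=> j; rewrite ffunE complex_ImD /=; have [_|_] := eqVneq j k.
    by rewrite mulr1n addr_ge0 // ltW.
  by rewrite mulr0n addr0.
- move=> j js; rewrite ffunE complex_ImD /=; have [->|jk] := eqVneq j k.
    by rewrite mulr1n ltr_wpDl.
  by rewrite mulr0n addr0 zs // inE negb_or jk.
Qed.

Definition toC (x : {ffun I -> R}) : {ffun I -> C} := [ffun i => (x i)%:C].

Definition real_part F (x : {ffun I -> R}) : R := Re (F (toC x)).

Lemma toC_shift x i (s : R) : toC (shift x i s) = shift (toC x) i s%:C.
Proof.
by apply/ffunP => j; rewrite !ffunE rmorphD /= rmorphMn.
Qed.

Lemma real_part_diff F i x : diff (real_part F) i x = real_part (diff F i) x.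
Proof. by rewrite /diff /real_part toC_shift complex_ReB. Qed.

Lemma real_part_subdiff2 F a b x :
  subdiff2 (real_part F) a b x = real_part (subdiff2 F a b) x.
Proof. by rewrite /subdiff2 !real_part_diff /real_part !complex_ReB. Qed.

Lemma stable_real F x : stable F -> F (toC x) = (real_part F x)%:C.
Proof.
move=> [_ FJ _]; rewrite /real_part.
have := FJ (toC x); rewrite (_ : [ffun i => _] = toC x); last first.
  by apply/ffunP => i; rewrite !ffunE /= oppr0.
case: (F _) => u v /= [] /eqP; rewrite -addr_eq0 -mulr2n mulrn_eq0 /= => /eqP ->.
by [].
Qed.

Lemma stable_diff_real F i x : stable F ->
  diff F i (toC x) = (diff (real_part F) i x)%:C.
Proof.
by move=> Fs; rewrite /diff -[1]/(1%:C) -toC_shift !stable_real // rmorphB.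
Qed.

Lemma stable_diff2_real F i j x : stable F ->
  diff (diff F i) j (toC x) = (diff (diff (real_part F) i) j x)%:C.
Proof.
move=> Fs; rewrite {1}/diff -[1]/(1%:C) -toC_shift !stable_diff_real //.
by rewrite -rmorphB.
Qed.

(** At the point x + i e_j one has F = f + i f_j and F_i = f_i + i f_ij, so Im (F_i conj(F)) = f_ij
    f - f_i f_j, and [stable_diff_closed] applies. *)
Lemma rayleigh_real_part F : stable F -> rayleigh (real_part F).
Proof.
move=> Fs; have [FM _ _] := Fs; split=> [x i s|i j x].
  rewrite real_part_diff /real_part toC_shift FM complex_ReD /=.
  by rewrite complex_ReM /= mul0r subr0.
have := @stable_diff_closed F (shift (toC x) j (0 +i* 1)) i Fs.
rewrite (FM (toC x) j) (multiaffine_diff i FM (toC x) j) (stable_real x Fs).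
rewrite !(stable_diff_real _ _ Fs) (stable_diff2_real _ _ _ Fs) => H.
rewrite -subr_le0; apply: le_trans (H _); first by
  rewrite le_eqVlt; apply/orP; left; apply/eqP => /=; ring.
move=> k; rewrite !ffunE complex_ImD /=.
by have [_|_] := eqVneq k j; rewrite ?mulr1n ?mulr0n /= add0r.
Qed.

Lemma rayleigh_ext (f g : {ffun I -> R} -> R) : f =1 g -> rayleigh g -> rayleigh f.
Proof.
move=> fg [gM gD]; have dE i x : diff f i x = diff g i x by rewrite /diff !fg.
have dE2 i j x : diff (diff f i) j x = diff (diff g i) j x.
  by rewrite {1}/diff !dE.
by split=> [x i s|i j x]; rewrite ?dE2 ?dE !fg ?gM.
Qed.

Lemma rayleigh_subdiffs (J : finType) (a b : J -> I) F ps : stable F ->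
  rayleigh (subdiffs a b (real_part F) ps).
Proof.
move=> Fs; have Gs : stable (subdiffs a b F ps).
  by elim: ps => //= j ps; apply: stable_subdiff2.
apply: rayleigh_ext (rayleigh_real_part Gs).
elim: ps {Gs} => //= j ps IH x; rewrite -real_part_subdiff2.
by rewrite /subdiff2 /diff !IH.
Qed.

(* Abstract form of the Marcus-Spielman-Srivastava theorem. *)
Lemma stable_choices (J : finType) (a b : J -> I) F x (s : R) ps : uniq ps ->
  stable F -> above (real_part F) x -> 0 <= s ->
  (forall j, real_part F x <= s * subdiff2 (real_part F) (a j) (b j) x) ->
  exists sigma : J -> bool, above (real_part F)
    [ffun i => x i + s * \sum_(j <- ps) ((a j == i)%:R + (b j == i)%:R)
      - 2 * \sum_(j <- ps) ((if sigma j then a j else b j) == i)%:R].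
Proof.
move=> ps_uniq Fs Fx s0 Fxs.
have FR qs : rayleigh (subdiffs a b (real_part F) qs) by apply: rayleigh_subdiffs.
have [sigma] := above_choices ps_uniq FR (above_subdiffs FR Fx s0 Fxs).
move=> H; exists sigma; move: H; congr (above (real_part F) _); apply/ffunP => i.
by rewrite !ffunE foldr_shift2E.
Qed.

End Stable.

(** * Determinants and Hermitian forms *)

Section RankOne.
Variables (K : comNzRingType) (m : nat).

(* Both determinants are that of a bordered matrix, in which [s] multiplies one row. *)
Lemma det_rank1_affine (M : 'M[K]_m) (c : 'cV_m) (r : 'rV_m) :
  exists d, forall s, \det (M + s *: (c *m r)) = \det M + s * d.
Proof.
exists (\det (block_mx (0 : 'M_1) (- r) c M)) => s.
pose B := block_mx (1%:M : 'M_1) (- (s *: r)) c M.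
have -> : \det (M + s *: (c *m r)) = \det B.
  have -> : B = block_mx 1%:M 0 c 1%:M *m block_mx 1%:M (- (s *: r)) 0 (M + s *: (c *m r)).
    rewrite mulmx_block !mul1mx !mul0mx !mulmx1 !addr0 mulmxN -scalemxAr.
    by rewrite addrCA addNr addr0.
  by rewrite det_mulmx det_lblock det_ublock !det1 !mul1r.
rewrite (@determinant_multilinear _ _ B (block_mx 1%:M 0 c M)
  (block_mx 0 (- r) c M) (lshift m 0) 1 s).
- by rewrite det_lblock det1 !mul1r.
- rewrite /B !rowKu !row_id scale1r scale_row_mx add_row_mx scaler0 addr0 add0r.
  by rewrite scalerN.
- apply/matrixP => i j; rewrite [LHS]mxE [RHS]mxE (_ : lift _ i = rshift 1 i).
    by rewrite -[j]splitK /B; case: (split j) => k /=; rewrite ?block_mxEdl ?block_mxEdr.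
  exact/val_inj.
- apply/matrixP => i j; rewrite [LHS]mxE [RHS]mxE (_ : lift _ i = rshift 1 i).
    by rewrite -[j]splitK /B; case: (split j) => k /=; rewrite ?block_mxEdl ?block_mxEdr.
  exact/val_inj.
Qed.

End RankOne.

Section Hermitian.
Local Open Scope sesquilinear_scope.
Variables (C : numClosedFieldType) (m : nat).
Implicit Types (A M P T : 'M[C]_m) (w : 'rV[C]_m).

Definition qform M w : C := (w *m M *m w^t* ) 0 0.

Definition herm M := M^t* = M.

Lemma adjM p q r (A : 'M[C]_(p, q)) (B : 'M[C]_(q, r)) : (A *m B)^t* = B^t* *m A^t*.
Proof. by rewrite trmx_mul map_mxM. Qed.

Lemma adj_diag (d : 'rV[C]_m) : d \is a realmx -> (diag_mx d)^t* = diag_mx d.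
Proof.
by move=> dR; rewrite tr_diag_mx map_diag_mx realmxC.
Qed.

Lemma herm_spectral M : herm M -> exists P (d : 'rV[C]_m),
  [/\ P *m P^t* = 1%:M, P^t* *m P = 1%:M, d \is a realmx & M = P^t* *m diag_mx d *m P].
Proof.
move=> Mh; have MH : M \is hermsymmx.
  by apply/is_hermitianmxP; rewrite expr0 scale1r Mh.
exists (spectralmx M), (spectral_diag M).
have PU := spectral_unitarymx M; split.
- exact/unitarymxP.
- by rewrite -invmx_unitary // mulVmx // unitarymx_unit.
- exact: hermitian_spectral_diag_real.
- by rewrite -invmx_unitary //; apply/orthomx_spectralP/hermitian_normalmx.
Qed.

Lemma qform_conj M T w : qform (T^t* *m M *m T) w = qform M (w *m T^t*).
Proof. by rewrite /qform adjM trmxCK !mulmxA. Qed.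

Lemma qform_diag (d : 'rV[C]_m) w : qform (diag_mx d) w = \sum_i d 0 i * `|w 0 i| ^+ 2.
Proof.
rewrite /qform mxE; apply: eq_bigr => i _.
by rewrite mul_mx_diag !mxE mulrAC -normCK mulrC.
Qed.

Definition posdef M := herm M /\ forall w, w != 0 -> 0 < qform M w.

(** A spectral square root gives A = B^* B. A unitary [Q] then diagonalizes the congruent Hermitian
    matrix [M'], and [T = Q B] serves both forms. *)
Lemma simultaneous_diag A M : posdef A -> herm M ->
  exists T (d : 'rV[C]_m), [/\ T \in unitmx, d \is a realmx, A = T^t* *m T &
    M = T^t* *m diag_mx d *m T].
Proof.
move=> [Ah Apos] Mh; have [P [a [PPt PtP aR AE]]] := herm_spectral Ah.
have a_gt0 i : 0 < a 0 i.
  have := Apos (delta_mx 0 i *m P); rewrite AE qform_conj -mulmxA PPt mulmx1.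
  rewrite qform_diag (bigD1 i) //= big1 => [|j ji]; last first.
    by rewrite mxE (negPf ji) normr0 expr0n mulr0.
  rewrite !mxE !eqxx normr1 expr1n mulr1 addr0; apply.
  apply: contra (oner_neq0 C) => /eqP /(congr1 (fun X => X *m P^t*)).
  rewrite -mulmxA PPt mulmx1 mul0mx => /matrixP/(_ 0 i).
  by rewrite !mxE !eqxx => /eqP.
pose b : 'rV[C]_m := \row_i sqrtC (a 0 i).
have bR : b \is a realmx.
  by apply/mxOverP => i j; rewrite mxE realE sqrtC_ge0 ltW.
pose B := diag_mx b *m P.
have Bt : B^t* = P^t* *m diag_mx b by rewrite adjM adj_diag.
have AB : A = B^t* *m B.
  rewrite Bt mulmxA -[P^t* *m _ *m _]mulmxA mulmx_diag AE; congr (_ *m diag_mx _ *m _).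
  by apply/rowP => i; rewrite !mxE -expr2 sqrtCK.
have Bu : B \in unitmx.
  rewrite unitmx_mul (mulmx1_unit PPt).1 andbT unitmxE det_diag unitfE.
  by apply/prodf_neq0 => i _; rewrite mxE sqrtC_eq0 gt_eqF.
clearbody B.
pose M' := (invmx B)^t* *m M *m invmx B.
have M'h : herm M' by rewrite /herm /M' !adjM trmxCK Mh mulmxA.
have [Q [d [QQt QtQ dR M'E]]] := herm_spectral M'h.
exists (Q *m B), d; split => //.
- by rewrite unitmx_mul Bu (mulmx1_unit QQt).1.
- by rewrite adjM mulmxA -[B^t* *m _ *m _]mulmxA QtQ mulmx1.
- have -> : M = B^t* *m M' *m B.
    rewrite /M' 2!mulmxA -adjM mulVmx // trmx1 map_mx1 mul1mx.
    by rewrite -mulmxA mulVmx // mulmx1.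
  by rewrite M'E adjM !mulmxA.
Qed.

Lemma det_adj M : \det (M^t* ) = (\det M)^*%R.
Proof. by rewrite det_map_mx det_tr. Qed.

Lemma det_posdef A : posdef A -> 0 < \det A.
Proof.
move=> Apd; have h0 : herm 0 by rewrite /herm trmx0 map_mx0.
have [T [_ [Tu _ -> _]]] := simultaneous_diag Apd h0.
rewrite det_mulmx det_adj mulrC -normCK exprn_gt0 // normr_gt0.
by rewrite -unitfE -unitmxE.
Qed.

(** In a common diagonalization a negative entry [d 0 i] of [M] makes the determinant vanish at
    [r = - d 0 i]. This turns information on roots into an operator inequality. *)
Lemma qform_ge0_of_det A M : posdef A -> herm M ->
  (forall r, 0 <= r -> \det (M + r *: A) != 0) -> forall w, 0 <= qform M w.
Proof.
move=> Apd Mh det_neq0 w; have [T [d [Tu dR AE ME]]] := simultaneous_diag Apd Mh.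
rewrite ME qform_conj qform_diag; apply: sumr_ge0 => i _.
rewrite mulr_ge0 ?exprn_ge0 //.
have diR : d 0 i \is Num.real by move/mxOverP: dR.
rewrite real_leNgt ?real0 //; apply/negP => di_lt0.
have := det_neq0 (- d 0 i); rewrite oppr_ge0 (ltW di_lt0) => /(_ isT) /negP; apply.
have -> : M + - d 0 i *: A = T^t* *m diag_mx (d - const_mx (d 0 i)) *m T.
  rewrite ME AE raddfB /= mulmxBr mulmxBl; congr (_ + _).
  by rewrite diag_const_mx mul_mx_scalar -scalemxAl scaleNr.
by rewrite !det_mulmx det_diag (bigD1 i) //= !mxE subrr mul0r mulr0 mul0r eqxx.
Qed.

End Hermitian.

(** * The polynomial of a frame *)

Section Frames.
Local Open Scope sesquilinear_scope.
Variables (R : rcfType) (m n : nat).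
Local Notation C := R[i].
Local Notation Re := (@complex.Re R).
Local Notation Im := (@complex.Im R).
Implicit Types (w : 'rV[C]_m) (J S : {set 'I_n}).

(** Squared moduli and norms are taken in [R] so that the estimates are real ones. *)
Definition normsq (x : C) : R := Re x ^+ 2 + Im x ^+ 2.

Lemma normsqE x : (normsq x)%:C = `|x| ^+ 2.
Proof. exact: add_Re2_Im2. Qed.

Lemma normsq_ge0 x : 0 <= normsq x.
Proof. by rewrite addr_ge0 ?sqr_ge0. Qed.

Definition sqnorm w : R := Re '[w, w].

Lemma sqnormE w : (sqnorm w)%:C = '[w, w].
Proof. by apply: RRe_real; rewrite realE dnorm_ge0. Qed.

Lemma sqnorm_gt0 w : (0 < sqnorm w) = (w != 0).
Proof. by rewrite -ltcR sqnormE; apply: dnorm_gt0. Qed.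

Lemma sqnorm_ge0 w : 0 <= sqnorm w.
Proof. by rewrite -lecR sqnormE dnorm_ge0. Qed.

Lemma normsq_dot_le w w' : normsq '[w, w'] <= sqnorm w * sqnorm w'.
Proof.
by rewrite -lecR normsqE rmorphM /= !sqnormE (CauchySchwarz _ w w').1.
Qed.

Variable v : 'I_n -> 'rV[C]_m.

Definition energy J w : R := \sum_(i in J) normsq '[w, v i].

Definition rank1 i : 'M[C]_m := (v i)^t* *m v i.

Definition frame_mx J (c : 'I_n -> C) : 'M[C]_m := \sum_(i in J) c i *: rank1 i.

Lemma qformD (M N : 'M[C]_m) w : qform (M + N) w = qform M w + qform N w.
Proof. by rewrite /qform mulmxDr mulmxDl mxE. Qed.

Lemma qformZ c (M : 'M[C]_m) w : qform (c *: M) w = c * qform M w.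
Proof. by rewrite /qform -scalemxAr -scalemxAl mxE. Qed.

Lemma qform_rank1 i w : qform (rank1 i) w = (normsq '[w, v i])%:C.
Proof.
rewrite normsqE normCK /qform /rank1 mulmxA -mulmxA mxE big_ord1 dotmxE.
congr (_ * _); rewrite -[v i]trmxCK -adjM trmxCK.
by rewrite !mxE.
Qed.

Lemma qform_frame_mx J c w :
  qform (frame_mx J c) w = \sum_(i in J) c i * (normsq '[w, v i])%:C.
Proof.
rewrite /frame_mx; elim/big_rec2: _ => [|i x M _ <-].
  by rewrite /qform mulmx0 mul0mx mxE.
by rewrite qformD qformZ qform_rank1.
Qed.

Lemma frame_mx_adj J c : (frame_mx J c)^t* = frame_mx J (fun i => conjc (c i)).
Proof.
rewrite /frame_mx; elim/big_rec2: _ => [|i x M _ <-]; first by rewrite trmx0 map_mx0.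
rewrite linearD /= map_mxD linearZ /= map_mxZ; congr (_ *: _ + _).
by rewrite /rank1 adjM trmxCK.
Qed.

Lemma herm_frame_mx J (c : 'I_n -> R) : herm (frame_mx J (fun i => (c i)%:C)).
Proof.
by rewrite /herm frame_mx_adj; apply: eq_bigr => i _; rewrite conjc_real.
Qed.

Lemma qform_frame_mx_real J (c : 'I_n -> R) w :
  qform (frame_mx J (fun i => (c i)%:C)) w = (\sum_(i in J) c i * normsq '[w, v i])%:C.
Proof.
by rewrite qform_frame_mx rmorph_sum; apply: eq_bigr => i _; rewrite rmorphM.
Qed.

Lemma frame_mx_shift J c c' i s : (forall j, c' j = c j + s *+ (j == i)) ->
  frame_mx J c' = frame_mx J c + (s *+ (i \in J)) *: rank1 i.
Proof.
move=> cE; have -> : frame_mx J c' = frame_mx J c + \sum_(j in J) (s *+ (j == i)) *: rank1 j.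
  by rewrite -big_split; apply: eq_bigr => j _; rewrite cE scalerDl.
congr (_ + _); have [iJ|iJ] := boolP (i \in J).
  rewrite (bigD1 i) //= eqxx big1 ?addr0 // => j /andP[_ /negPf->].
  by rewrite scale0r.
rewrite scale0r big1 // => j jJ; case: eqP => [ji|_]; last by rewrite scale0r.
by rewrite -ji jJ in iJ.
Qed.

(** The variables [inl i] govern the chosen part of [J], the variables [inr i] its complement. *)
Definition frame_poly J (z : {ffun 'I_n + 'I_n -> C}) : C :=
  \det (frame_mx J (fun i => z (inl i))) * \det (frame_mx J (fun i => z (inr i))).

Lemma det_frame_mx_shift J c i : exists d, forall c' s,
  (forall j, c' j = c j + s *+ (j == i)) ->
  \det (frame_mx J c') = \det (frame_mx J c) + s * d.
Proof.
have [d dE] := det_rank1_affine (frame_mx J c) ((v i)^t* ) (v i).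
exists (d *+ (i \in J)) => c' s /(frame_mx_shift J) ->.
by rewrite dE; case: (i \in J); rewrite ?mulr0 ?mul0r.
Qed.

Lemma multiaffine_frame_poly J : multiaffine (frame_poly J).
Proof.
(* Any slope will do, because [s = 1] identifies it with the unit difference. *)
suff H z i : exists d, forall s, frame_poly J (shift z i s) = frame_poly J z + s * d.
  by move=> z i s; have [d dE] := H z i; rewrite /diff !dE; ring.
case: i => i.
  have [d dE] := det_frame_mx_shift J (fun i => z (inl i)) i.
  exists (d * \det (frame_mx J (fun i => z (inr i)))) => s; rewrite /frame_poly.
  rewrite (dE _ s); last by move=> j; rewrite ffunE.
  have -> : frame_mx J (fun k => shift z (inl i) s (inr k)) = frame_mx J (fun k => z (inr k)).
    by apply: eq_bigr => j _; rewrite ffunE addr0.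
  ring.
have [d dE] := det_frame_mx_shift J (fun i => z (inr i)) i.
exists (\det (frame_mx J (fun i => z (inl i))) * d) => s; rewrite /frame_poly.
rewrite (dE (fun k => shift z (inr i) s (inr k)) s); last by move=> j; rewrite ffunE.
have -> : frame_mx J (fun k => shift z (inr i) s (inl k)) = frame_mx J (fun k => z (inl k)).
  by apply: eq_bigr => j _; rewrite ffunE addr0.
ring.
Qed.

Section LowerBound.
Variables (J : {set 'I_n}) (alpha : R).
Hypothesis alpha_gt0 : 0 < alpha.
Hypothesis alpha_le : forall w, alpha * sqnorm w <= energy J w.

Lemma energy_gt0 w : w != 0 -> 0 < energy J w.
Proof.
by move=> w0; apply: lt_le_trans (alpha_le w); rewrite mulr_gt0 // sqnorm_gt0.
Qed.

(** For a kernel vector [w] the imaginary part of the form at [w] is a sum of nonnegative terms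
    equal to 0, so [w] has zero energy, against the lower frame bound. *)
Lemma det_frame_mx_neq0 c : (forall i, 0 < Im (c i)) -> \det (frame_mx J c) != 0.
Proof.
move=> c_gt0; apply/negP => /det0P[w w0 wM].
have : qform (frame_mx J c) w = 0 by rewrite /qform wM mul0mx mxE.
rewrite qform_frame_mx => /(congr1 Im).
have -> : Im (\sum_(i in J) c i * (normsq '[w, v i])%:C) =
    \sum_(i in J) Im (c i) * normsq '[w, v i].
  elim/big_rec2: _ => [//|i x y _ <-].
  by rewrite complex_ImD complex_ImM /= mulr0 add0r.
move=> /eqP; rewrite psumr_eq0 => [/allP Z|i _]; last by rewrite mulr_ge0 ?normsq_ge0 ?ltW.
have := energy_gt0 w0; rewrite /energy big1 ?ltxx // => i iJ.
have /implyP/(_ iJ) := Z i (mem_index_enum i).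
by rewrite mulf_eq0 gt_eqF //= => /eqP.
Qed.

Lemma stable_frame_poly : stable (frame_poly J).
Proof.
split; first exact: multiaffine_frame_poly.
  have conjE c : conjc (\det (frame_mx J c)) = \det (frame_mx J (fun i => conjc (c i))).
    by rewrite -frame_mx_adj det_adj.
  move=> z; rewrite /frame_poly rmorphM /= !conjE.
  by congr (_ * _); congr determinant; apply: eq_bigr => i _; rewrite ffunE.
by move=> z z_gt0; rewrite mulf_neq0 // det_frame_mx_neq0.
Qed.

Lemma posdef_frame_mx (c : 'I_n -> R) (t : R) : 0 < t -> (forall i, t <= c i) ->
  posdef (frame_mx J (fun i => (c i)%:C)).
Proof.
move=> t0 tc; split=> [|w w0]; first exact: herm_frame_mx.
rewrite qform_frame_mx_real ltcR; apply: (@lt_le_trans _ _ (t * energy J w)).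
  by rewrite mulr_gt0 // energy_gt0.
by rewrite mulr_sumr ler_sum // => i _; rewrite ler_wpM2r ?normsq_ge0.
Qed.

Definition frame_det (c : 'I_n -> R) : R := Re (\det (frame_mx J (fun i => (c i)%:C))).

Lemma frame_detE c : (frame_det c)%:C = \det (frame_mx J (fun i => (c i)%:C)).
Proof. by apply: RRe_real; apply/CrealP; rewrite -det_adj herm_frame_mx. Qed.

Lemma eq_frame_det c c' : {in J, c =1 c'} -> frame_det c = frame_det c'.
Proof.
move=> cc'; rewrite /frame_det; congr (Re (determinant _)).
by apply: eq_bigr => i iJ; rewrite cc'.
Qed.

Lemma frame_det_gt0 c : (forall w, w != 0 -> 0 < \sum_(i in J) c i * normsq '[w, v i]) ->
  0 < frame_det c.
Proof.
move=> c_gt0; rewrite -ltcR frame_detE; apply: det_posdef.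
by split=> [|w w0]; [exact: herm_frame_mx|rewrite qform_frame_mx_real ltcR c_gt0].
Qed.

Lemma real_part_frame_poly y : real_part (frame_poly J) y =
  frame_det (fun i => y (inl i)) * frame_det (fun i => y (inr i)).
Proof.
apply: complexI; rewrite -(stable_real y stable_frame_poly) rmorphM /= !frame_detE.
rewrite /frame_poly; congr (_ * _); congr determinant;
  by apply: eq_bigr => i _; rewrite ffunE.
Qed.

Lemma above_frame_poly (t : R) : 0 < t ->
  above (real_part (frame_poly J)) [ffun=> t].
Proof.
move=> t0 y ty; have ty' k : t <= y k by have := ty k; rewrite ffunE.
suff H (c : 'I_n -> R) : (forall i, t <= c i) -> 0 < frame_det c.
  by rewrite real_part_frame_poly mulr_gt0 ?H.
move=> tc; apply: frame_det_gt0 => w w0.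
apply: (@lt_le_trans _ _ (t * energy J w)); first by rewrite mulr_gt0 // energy_gt0.
by rewrite mulr_sumr ler_sum // => i _; rewrite ler_wpM2r ?normsq_ge0.
Qed.

Lemma frame_ge0_of_det c : (forall r, 0 <= r -> frame_det (fun i => c i + r) != 0) ->
  forall w, 0 <= \sum_(i in J) c i * normsq '[w, v i].
Proof.
move=> det_neq0 w; rewrite -lecR -qform_frame_mx_real.
apply: (qform_ge0_of_det (posdef_frame_mx ltr01 (c := fun=> 1) _)) => //.
  exact: herm_frame_mx.
move=> r r0; have rE : r = (Re r)%:C by rewrite RRe_real // realE r0.
have Rer0 : 0 <= Re r by rewrite -lecR -rE.
have -> : frame_mx J (fun i => (c i)%:C) + r *: frame_mx J (fun=> 1%:C) =
    frame_mx J (fun i => (c i + Re r)%:C).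
  rewrite /frame_mx scaler_sumr -big_split; apply: eq_bigr => i _.
  by rewrite /= rmorphD /= -rE scalerDl scale1r.
by rewrite -frame_detE (inj_eq (@complexI R)) det_neq0.
Qed.

(** * The barrier at a constant point and the splitting of a frame *)

Section Barrier.
Variables (eps t : R).
Hypotheses (eps_gt0 : 0 < eps) (t_gt0 : 0 < t).
Hypothesis sqnorm_le : forall i, sqnorm (v i) <= eps.

(* [det (t A + s v_i v_i^* )] is affine in [s] and positive for
   [s > - alpha t / eps], which bounds its slope. *)
Lemma frame_det_slope c i : (forall j, c j = t + (j == i)%:R) ->
  frame_det c - frame_det (fun=> t) <= eps / (alpha * t) * frame_det (fun=> t).
Proof.
move=> cE; set d0 := frame_det (fun=> t).
have [d dE] := det_frame_mx_shift J (fun=> t%:C) i.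
have dr s : frame_det (fun j => t + s *+ (j == i)) = d0 + s * (frame_det c - d0).
  have E r : (frame_det (fun j => t + r *+ (j == i)))%:C = d0%:C + r%:C * d.
    by rewrite !frame_detE; apply: dE => j; rewrite rmorphD rmorphMn.
  have c1 : (frame_det c)%:C = d0%:C + d.
    by rewrite (eq_frame_det (in1W cE)) (E 1) mul1r.
  by apply: complexI; rewrite E rmorphD rmorphM rmorphB /= c1; ring.
have pos s : - (alpha * t / eps) < s -> 0 < d0 + s * (frame_det c - d0).
  move=> hs; rewrite -dr; apply: frame_det_gt0 => w w0.
  have e0 := energy_gt0 w0.
  have -> : \sum_(j in J) (t + s *+ (j == i)) * normsq '[w, v j] =
      t * energy J w + s * (normsq '[w, v i] *+ (i \in J)).
    rewrite /energy mulr_sumr; under eq_bigr do rewrite mulrDl.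
    rewrite big_split /=; congr (_ + _); have [iJ|iJ] := boolP (i \in J).
      rewrite (bigD1 i) //= eqxx big1 ?addr0 // => j /andP[_ /negPf->].
      by rewrite mul0r.
    rewrite mulr0 big1 // => j jJ; case: eqP => [ji|_]; last by rewrite mul0r.
    by rewrite -ji jJ in iJ.
  (* Cauchy-Schwarz followed by the lower frame bound. *)
  have nle : alpha * (normsq '[w, v i] *+ (i \in J)) <= eps * energy J w.
    apply: (@le_trans _ _ (alpha * (eps * sqnorm w))).
      rewrite ler_pM2l //; apply: (@le_trans _ _ (normsq '[w, v i])).
        by case: (i \in J); rewrite ?mulr1n // normsq_ge0.
      by apply: le_trans (normsq_dot_le _ _) _; rewrite mulrC ler_wpM2r ?sqnorm_ge0.
    by rewrite mulrCA ler_pM2l.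
  set x := normsq _ *+ _ in nle *.
  have x0 : 0 <= x by rewrite mulrn_wge0 // normsq_ge0.
  have te : 0 < t * energy J w by rewrite mulr_gt0.
  have [s0|s0] := leP 0 s; first by rewrite ltr_wpDr // mulr_ge0.
  have hs' : - (alpha * t) < s * eps by rewrite -ltr_pdivrMr // mulNr.
  rewrite -(pmulr_rgt0 _ alpha_gt0).
  have := ler_wnM2l (ltW s0) nle.
  have : 0 < (s * eps + alpha * t) * energy J w by rewrite mulr_gt0 //; lra.
  lra.
have d0_gt0 : 0 < d0.
  rewrite -[d0]addr0 -[X in _ + X](mul0r (frame_det c - d0)) pos //.
  by rewrite oppr_lt0 divr_gt0 // mulr_gt0.
rewrite leNgt; apply/negP => h.
have k0 : 0 < eps / (alpha * t) * d0 by rewrite mulr_gt0 // divr_gt0 // mulr_gt0.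
have D0 : 0 < frame_det c - d0 by apply: lt_trans h.
(* Too large a slope would put the root of the affine function inside the range where [pos] makes it
   positive. *)
have := pos (- (d0 / (frame_det c - d0))); rewrite mulNr divfK ?gt_eqF // subrr ltxx.
move=> H; apply/notF/H; rewrite ltrN2 ltr_pdivrMr //.
move: h; rewrite mulrAC ltr_pdivrMr ?mulr_gt0 // => h.
rewrite mulrAC ltr_pdivlMr // ; lra.
Qed.

(** Each of the two variables enters only one factor of the product, so both barriers equal (d1 -
    d0) / d0, which [frame_det_slope] bounds. *)
Lemma frame_poly_barrier (s : R) i : 1 <= s * (1 - 2 * (eps / (alpha * t))) -> 0 <= s ->
  real_part (frame_poly J) [ffun=> t] <=
  s * subdiff2 (real_part (frame_poly J)) (inl i) (inr i) [ffun=> t].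
Proof.
move=> hs s0; rewrite /subdiff2 /diff !real_part_frame_poly.
set d0 := frame_det (fun=> t).
set x : {ffun 'I_n + 'I_n -> R} := [ffun=> t].
pose d1 := frame_det (fun j => t + (j == i)%:R).
have d1E : d1 - d0 <= eps / (alpha * t) * d0 by exact: (frame_det_slope (i := i)).
have e1 : frame_det (fun j => x (inl j)) = d0 by apply: eq_frame_det => j _; rewrite ffunE.
have e2 : frame_det (fun j => x (inr j)) = d0 by apply: eq_frame_det => j _; rewrite ffunE.
have e3 : frame_det (fun j => shift x (inl i) 1 (inl j)) = d1.
  by apply: eq_frame_det => j _; rewrite !ffunE.
have e4 : frame_det (fun j => shift x (inl i) 1 (inr j)) = d0.
  by apply: eq_frame_det => j _; rewrite !ffunE addr0.
have e5 : frame_det (fun j => shift x (inr i) 1 (inl j)) = d0.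
  by apply: eq_frame_det => j _; rewrite !ffunE addr0.
have e6 : frame_det (fun j => shift x (inr i) 1 (inr j)) = d1.
  by apply: eq_frame_det => j _; rewrite !ffunE.
rewrite e1 e2 e3 e4 e5 e6.
have d0_gt0 : 0 < d0.
  apply: frame_det_gt0 => w w0; rewrite -mulr_sumr mulr_gt0 //; exact: energy_gt0.
have h1 := ler_wpM2l (mulr_ge0 s0 (ltW d0_gt0)) d1E.
have h2 := ler_wpM2r (mulr_ge0 (ltW d0_gt0) (ltW d0_gt0)) hs.
move: h1 h2; set q := eps / _; lra.
Qed.

Lemma energy_le_of_det (P : pred 'I_n) (u : R) :
  (forall r, 0 <= r -> frame_det (fun i => u - 2 * (P i)%:R + r) != 0) ->
  forall w, energy [set i in J | P i] w *+ 2 <= u * energy J w.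
Proof.
move=> /frame_ge0_of_det H w; rewrite -subr_ge0; apply: le_trans (H w) _.
rewrite le_eqVlt; apply/orP; left; apply/eqP.
under eq_bigr do rewrite mulrBl.
rewrite sumrB -mulr_sumr; congr (_ - _).
have -> : energy [set i in J | P i] w = \sum_(i in J | P i) normsq '[w, v i].
  by apply: eq_bigl => i; rewrite inE.
rewrite -sumrMnl [RHS]big_mkcondr /=; apply: eq_bigr => i _.
by case: (P i); rewrite ?mulr0 ?mul0r // mulr1 mulr_natl.
Qed.

(** From the constant point [t], every coordinate of [J] rises by [s] once and then drops by 2 if
    its sign is chosen. Lying above the roots there says that (t + s) A_J - 2 A_S is positive
    semidefinite, and likewise for the complement. *)
Lemma energy_split (s : R) : 1 <= s * (1 - 2 * (eps / (alpha * t))) -> 0 <= s ->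
  exists2 S : {set 'I_n}, S \subset J & forall w,
    energy S w *+ 2 <= (t + s) * energy J w /\
    energy (J :\: S) w *+ 2 <= (t + s) * energy J w.
Proof.
move=> hs s0.
have [] := @stable_choices R _ _ inl inr (frame_poly J) [ffun=> t] s (enum J).
- exact: enum_uniq.
- exact: stable_frame_poly.
- exact: above_frame_poly.
- exact: s0.
- by move=> j; apply: frame_poly_barrier.
move=> sigma; set y := (X in above _ X) => fy.
have sumE (P : pred 'I_n) k : k \in J ->
    \sum_(j <- enum J) (P j && (j == k))%:R = (P k)%:R :> R.
  move=> kJ; rewrite big_enum /= (bigD1 k) //= eqxx andbT big1 ?addr0 //.
  by move=> j /andP[_ /negPf->]; rewrite andbF.
have sum1 k : k \in J -> \sum_(j <- enum J) (j == k)%:R = 1 :> R.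
  exact: (sumE predT).
have yE (A B B' : R) : A = 1 -> B = B' -> t + s * A - 2 * B = t + s - 2 * B'.
  by move=> -> ->; rewrite mulr1.
have yl k : k \in J -> y (inl k) = t + s - 2 * (sigma k)%:R.
  move=> kJ; rewrite !ffunE; apply: yE.
    by apply: etrans (sum1 k kJ); apply: eq_bigr => j _; rewrite addr0.
  by apply: etrans (sumE sigma k kJ); apply: eq_bigr => j _; case: (sigma j).
have yr k : k \in J -> y (inr k) = t + s - 2 * (~~ sigma k)%:R.
  move=> kJ; rewrite !ffunE; apply: yE.
    by apply: etrans (sum1 k kJ); apply: eq_bigr => j _; rewrite add0r.
  by apply: etrans (sumE (predC sigma) k kJ); apply: eq_bigr => j _ /=; case: (sigma j).
(* Adding [r] to all coordinates stays above the roots, and a nonzero product has both factors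
   nonzero. *)
have det_neq0 r : 0 <= r -> frame_det (fun i => t + s - 2 * (sigma i)%:R + r) != 0 /\
    frame_det (fun i => t + s - 2 * (~~ sigma i)%:R + r) != 0.
  move=> r0; have := fy [ffun i => y i + r].
  rewrite real_part_frame_poly => H; apply/andP; rewrite -negb_or -mulf_eq0 gt_eqF //.
  rewrite -[X in X * _](@eq_frame_det (fun i => [ffun i => y i + r] (inl i))); last first.
    by move=> k kJ; rewrite /= ffunE yl.
  rewrite -[X in _ * X](@eq_frame_det (fun i => [ffun i => y i + r] (inr i))); last first.
    by move=> k kJ; rewrite /= ffunE yr.
  by apply: H => k; rewrite [leRHS]ffunE lerDl.
exists [set i in J | sigma i]; first by apply/subsetP => i; rewrite inE => /andP[].
have -> : J :\: [set i in J | sigma i] = [set i in J | ~~ sigma i].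
  by apply/setP => i; rewrite !inE; case: (i \in J); rewrite ?andbF ?andbT.
by move=> w; split; apply: energy_le_of_det => r /det_neq0[].
Qed.
End Barrier.
End LowerBound.
End Frames.

(** * Halving a frame *)

Section HalvingInvariant.
Variable R : rcfType.
Local Notation sqrt2 := (Num.sqrt 2 : R).

Lemma sqrt2_bounds : [/\ sqrt2 ^+ 2 = 2, 24 / 17 < sqrt2 & sqrt2 < 17 / 12].
Proof.
have s2 : sqrt2 ^+ 2 = 2 by rewrite sqr_sqrtr.
have s0 : 0 <= sqrt2 by rewrite sqrtr_ge0.
split => //; rewrite -(ltr_pXn2r (n := 2)) ?nnegrE // ?s2 //; lra.
Qed.

(* [u ^ 2] is the ratio of the lower frame bound to [eps] and [y ^ 2] is proportional
   to the upper one; the invariant keeps [y / u] bounded through the halvings.  It is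
   preserved because [z - 3 / 2 <= u' <= z] for [z = u / sqrt 2]. *)
Lemma halving_invariant (u y : R) : 2 + sqrt2 <= u -> 0 < y ->
  y * u <= (u + 26 / 5) * (u + 7) -> 1642 < y ^+ 2 ->
  let u' := Num.sqrt (u ^+ 2 / 2 - sqrt2 * u - 1) in
  let y' := y * (1 + sqrt2 / u) / sqrt2 in
  [/\ u' ^+ 2 = u ^+ 2 / 2 - sqrt2 * u - 1, 2 + sqrt2 <= u' &
    y' * u' <= (u' + 26 / 5) * (u' + 7)].
Proof.
move=> u_ge y0 yu y2 u' y'; have [s2 s_gt s_lt] := sqrt2_bounds.
have y_gt : 40 < y.
  rewrite -(ltr_pXn2r (n := 2)) ?nnegrE ?(ltW y0) //; lra.
clear y2.
(* For smaller [u] the invariant would force [y <= 40]. *)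
have u7 : 7 < u.
  rewrite ltNge; apply/negP => u7.
  have : (u + 26 / 5) * (u + 7) <= 40 * u.
    have : 0 <= (u - 3) * (7 - u) by rewrite mulr_ge0 //; lra.
    lra.
  move=> /(le_trans yu); rewrite ler_pM2r; last by lra.
  lra.
have u0 : 0 < u by lra.
have hu : (2 + sqrt2) ^+ 2 <= u ^+ 2 / 2 - sqrt2 * u - 1.
  have : 0 <= (u - 7) * (u / 2 - 2) by rewrite mulr_ge0 //; lra.
  have : 0 <= (17 / 12 - sqrt2) * u by rewrite mulr_ge0 //; lra.
  lra.
have u'2 : u' ^+ 2 = u ^+ 2 / 2 - sqrt2 * u - 1.
  by rewrite sqr_sqrtr // (le_trans _ hu) ?sqr_ge0.
have u'0 : 0 <= u' by rewrite sqrtr_ge0.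
have u'_ge : 2 + sqrt2 <= u'.
  by rewrite -(ler_pXn2r (n := 2)) ?nnegrE ?u'2 //; lra.
split => //.
pose z := u / sqrt2.
have zs : z * sqrt2 = u by rewrite /z divfK //; lra.
have z0 : 0 < z by rewrite divr_gt0 //; lra.
have zV : sqrt2 / u = z^-1 by rewrite /z invf_div.
clearbody z.
have z2 : z ^+ 2 = u ^+ 2 / 2 by rewrite -zs exprMn s2; field.
have su : sqrt2 * u = 2 * z.
  by rewrite -zs mulrCA -expr2 s2 mulrC.
have z_gt : 84 / 17 < z.
  have : 0 <= (17 / 12 - sqrt2) * z by rewrite mulr_ge0 //; lra.
  lra.
have u'_lo : z - 3 / 2 <= u'.
  rewrite leNgt; apply/negP => h.
  have : u' ^+ 2 < (z - 3 / 2) ^+ 2 by rewrite ltr_pXn2r ?nnegrE //; lra.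
  rewrite u'2 su -z2; lra.
have u'_hi : u' <= z by rewrite -(ler_pXn2r (n := 2)) ?nnegrE ?u'2 ?z2 ?su //; lra.
have y's : y' * (sqrt2 * z) = y * (z + 1).
  rewrite /y' zV.
  by field; rewrite !gt_eqF //; lra.
have z1 : 0 < sqrt2 * z * u by rewrite !mulr_gt0 //; lra.
rewrite -(ler_pM2r z1).
have -> : y' * u' * (sqrt2 * z * u) = y * u * ((z + 1) * u').
  have -> : y * u * ((z + 1) * u') = y * (z + 1) * (u * u') by ring.
  by rewrite -y's; ring.
(* The factors of the invariant are compared one by one: [b1] absorbs the loss of 3/2 in [u'], while
   [b2] and [b3] trade the growth factor (z + 1) / z of [y] against the summand 7. *)
have b1 : u + 26 / 5 <= sqrt2 * (u' + 26 / 5).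
  have : 0 <= sqrt2 * (u' - (z - 3 / 2)) by rewrite mulr_ge0 //; lra.
  lra.
have b2 : (u + 7) * (z + 1) <= (z + 7) * u.
  have : 0 <= (sqrt2 - 24 / 17) * z by rewrite mulr_ge0 //; lra.
  lra.
have b3 : (z + 7) * u' <= z * (u' + 7) by lra.
have h1 : y * u * ((z + 1) * u') <= (u + 26 / 5) * (u + 7) * ((z + 1) * u').
  by apply: ler_wpM2r => //; rewrite mulr_ge0 //; lra.
have h2 : (u + 26 / 5) * ((u + 7) * (z + 1) * u') <=
    sqrt2 * (u' + 26 / 5) * ((u + 7) * (z + 1) * u').
  by apply: ler_wpM2r => //; rewrite !mulr_ge0 //; lra.
have c0 : 0 <= sqrt2 * (u' + 26 / 5) by rewrite mulr_ge0 //; lra.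
have h3 := ler_wpM2l c0 (ler_wpM2r u'0 b2).
have h4 := ler_wpM2l c0 (ler_wpM2r (ltW u0) b3).
lra.
Qed.

End HalvingInvariant.

Section Halving.
Variables (R : rcfType) (m n : nat) (v : 'I_n -> 'rV[R[i]]_m) (eps : R).
Hypothesis eps_gt0 : 0 < eps.
Hypothesis sqnorm_le : forall i, sqnorm (v i) <= eps.
Local Notation sqrt2 := (Num.sqrt 2 : R).

(** The upper bound for one part is the lower bound for the other, so both parts satisfy the same
    estimates and the smaller one is kept. *)
Lemma halving (J : {set 'I_n}) (u : R) : 0 < u ->
  (forall w, eps * u ^+ 2 * sqnorm w <= energy v J w) ->
  exists2 S : {set 'I_n}, (#|S|.*2 <= #|J|)%N & forall w,
    (1 - (1 + sqrt2 / u) ^+ 2 / 2) * energy v J w <= energy v S w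
      <= (1 + sqrt2 / u) ^+ 2 / 2 * energy v J w.
Proof.
move=> u0 lower; have [s2 s_gt s_lt] := sqrt2_bounds R.
set q := sqrt2 / u.
have q0 : 0 < q by rewrite divr_gt0 //; lra.
have al0 : 0 < eps * u ^+ 2 by rewrite mulr_gt0 // exprn_gt0.
(* With [t = q (1 + q)] and [s = 1 + q] the barrier condition is an equality, and t + s = (1 +
   q)^2. *)
have t0 : 0 < q * (1 + q) by rewrite mulr_gt0 //; lra.
have q2 : eps / (eps * u ^+ 2 * (q * (1 + q))) = q / (2 * (1 + q)).
  have u2 : u ^+ 2 * q ^+ 2 = 2 by rewrite /q expr_div_n s2; field; rewrite gt_eqF.
  have d1 : 0 < eps * u ^+ 2 * (q * (1 + q)) by rewrite mulr_gt0.
  have d2 : 0 < 2 * (1 + q) by lra.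
  apply/eqP; rewrite eqr_div ?(lt0r_neq0 d1) ?(lt0r_neq0 d2) //.
  by apply/eqP; rewrite -[in LHS]u2; ring.
have [||S SJ HS] := @energy_split R m n v J _ al0 lower _ _ eps_gt0 t0 sqnorm_le (1 + q).
- rewrite q2; suff -> : (1 + q) * (1 - 2 * (q / (2 * (1 + q)))) = 1 by [].
  by field; rewrite gt_eqF //; lra.
- by lra.
have uE : q * (1 + q) + (1 + q) = (1 + q) ^+ 2 by ring.
rewrite uE in HS.
have energyD w : energy v J w = energy v S w + energy v (J :\: S) w.
  by rewrite /energy (big_setID S) /= (setIidPr SJ).
have [cardS|cardS] := leqP (#|S|.*2) #|J|.
  by exists S => // w; have [] := HS w; have := energyD w; lra.
exists (J :\: S) => [|w]; last by have [] := HS w; have := energyD w; lra.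
rewrite cardsD (setIidPr SJ) doubleB leq_subLR -addnn leq_add2r.
exact: ltnW.
Qed.

(** Halving goes on until [y ^+ 2 <= 1642]. A step multiplies [y ^+ 2] by (1 + q)^2 / 2, which is at
    least 1/2, so [nu * y ^+ 2] keeps bounding the cardinality as well. *)
Lemma iterated_halving (kappa nu : R) (J : {set 'I_n}) (u y : R) : 0 < kappa -> 0 < nu ->
  2 + sqrt2 <= u -> 0 < y -> y * u <= (u + 26 / 5) * (u + 7) ->
  #|J|%:R <= nu * y ^+ 2 ->
  (forall w, eps * u ^+ 2 * sqnorm w <= energy v J w <= kappa * y ^+ 2 * sqnorm w) ->
  exists2 S : {set 'I_n}, #|S|%:R <= nu * 1642 & forall w,
    eps * (2 + sqrt2) ^+ 2 * sqnorm w <= energy v S w <= kappa * 1642 * sqnorm w.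
Proof.
move=> kappa0 nu0; have [s2 s_gt s_lt] := sqrt2_bounds R.
have [k] := ubnP #|J|; elim: k => // k IH in J u y * => Jk u_ge y0 yu cardJ HJ.
have u0 : 0 < u by lra.
have lower w : eps * (2 + sqrt2) ^+ 2 * sqnorm w <= energy v J w.
  have /andP[+ _] := HJ w; apply: le_trans.
  rewrite ler_wpM2r ?sqnorm_ge0 // ler_pM2l // ler_pXn2r ?nnegrE //; lra.
have [y2|y2] := leP (y ^+ 2) 1642.
  exists J; first by apply: le_trans cardJ _; rewrite ler_pM2l.
  move=> w; rewrite lower; have /andP[_ H] := HJ w; apply: le_trans H _.
  by rewrite ler_wpM2r ?sqnorm_ge0 // ler_pM2l.
(* Halving strictly shrinks only a nonempty set, so the empty one is treated apart. *)
have [cardJ0|cardJ0] := posnP #|J|.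
  exists J; first by rewrite cardJ0 mulr_ge0 // ltW.
  move=> w; rewrite lower (cards0_eq cardJ0) /energy big_set0.
  by rewrite !mulr_ge0 ?sqnorm_ge0 // ltW.
have lowerJ w : eps * u ^+ 2 * sqnorm w <= energy v J w by have /andP[] := HJ w.
have [S cardS HS] := halving u0 lowerJ.
have [u'2 u'_ge] := halving_invariant u_ge y0 yu y2.
set q := sqrt2 / u in HS *.
set u' := Num.sqrt _ in u'2 u'_ge *; set y' := _ / sqrt2 => y'u'.
have s0 : 0 < sqrt2 by lra.
have q0 : 0 < q by rewrite divr_gt0.
have q1 : 0 < 1 + q by rewrite addr_gt0.
have qu : q * u = sqrt2 by rewrite divfK // gt_eqF.
have y'2 : y' ^+ 2 = y ^+ 2 * ((1 + q) ^+ 2 / 2).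
  by rewrite /y' expr_div_n exprMn s2 mulrA.
have u'E : u' ^+ 2 = u ^+ 2 * (1 - (1 + q) ^+ 2 / 2).
  have -> : u ^+ 2 * (1 - (1 + q) ^+ 2 / 2) = u ^+ 2 / 2 - q * u * u - (q * u) ^+ 2 / 2.
    by field.
  by rewrite u'2 qu s2 divff // pnatr_eq0.
apply: (IH S u' y') => //.
- rewrite -ltnS; apply: leq_trans Jk; rewrite ltnS -(ltn_pmul2r (m := 2)) // !muln2.
  by apply: leq_ltn_trans cardS _; rewrite -addnn -[X in (X < _)%N]addn0 ltn_add2l.
- by rewrite divr_gt0 ?mulr_gt0.
- have cS : #|S|%:R * 2 <= #|J|%:R :> R by rewrite -natrM muln2 ler_nat.
  have ny : 0 <= nu * y ^+ 2 by rewrite mulr_ge0 ?sqr_ge0 ?ltW.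
  have qq : 1 <= (1 + q) ^+ 2 by rewrite exprn_ege1 // lerDl ltW.
  have := ler_wpM2l ny qq; rewrite y'2; clear - cS cardJ; lra.
move=> w; have /andP[H1 H2] := HJ w; have /andP[H3 H4] := HS w.
apply/andP; split.
  apply: le_trans H3; rewrite u'E mulrA mulrAC mulrC ler_wpM2l //.
  by rewrite -(pmulr_rge0 _ (exprn_gt0 2 u0)) -u'E sqr_ge0.
apply: le_trans H4 _; rewrite y'2.
have p0 : 0 <= (1 + q) ^+ 2 / 2 by rewrite divr_ge0 ?sqr_ge0.
have := ler_wpM2l p0 H2; clear; lra.
Qed.

End Halving.

(** * Small subframes *)

Section Subframes.
Local Open Scope sesquilinear_scope.
Variables (R : realType) (m n : nat) (u : 'I_n -> 'rV[R[i]]_m).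

Lemma sqr_l2norm (w : 'rV[R[i]]_m) : l2norm w ^+ 2 = (sqnorm w)%:C.
Proof. by rewrite sqrtCK sqnormE. Qed.

Lemma frame_boundsP (J : {set 'I_n}) (a b : R) : frame_bounds u J a b <->
  forall w, a * sqnorm w <= energy u J w <= b * sqnorm w.
Proof.
suff E w : (a%:C * l2norm w ^+ 2 <= \sum_(i in J) `|'[w, u i]| ^+ 2
    <= b%:C * l2norm w ^+ 2) = (a * sqnorm w <= energy u J w <= b * sqnorm w).
  by split=> H w; [rewrite -E|rewrite E].
have -> : \sum_(i in J) `|'[w, u i]| ^+ 2 = (energy u J w)%:C.
  by rewrite rmorph_sum; apply: eq_bigr => i _; rewrite -normsqE.
by rewrite sqr_l2norm -!rmorphM !lecR.
Qed.

Lemma has_small_subframe_weaken (c1 c2 c3 d1 d2 d3 : R) :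
  c1 <= d1 -> d2 <= c2 -> c3 <= d3 ->
  has_small_subframe u c1 c2 c3 -> has_small_subframe u d1 d2 d3.
Proof.
move=> cd1 cd2 cd3 [J [cardJ /frame_boundsP HJ]]; exists J; split.
  by apply: le_trans cardJ _; rewrite ler_wpM2r.
apply/frame_boundsP => w; have /andP[H1 H2] := HJ w; apply/andP; split.
  by apply: le_trans H1; rewrite !ler_wpM2r ?sqnorm_ge0 ?divr_ge0.
by apply: le_trans H2 _; rewrite !ler_wpM2r ?sqnorm_ge0 ?divr_ge0.
Qed.

(** With fewer than [m] vectors, some nonzero [w] is orthogonal to all of them. This rules out n/m <
    1, so the two regimes cover every case. *)
Lemma frame_dim_le (a : R) : 0 < a ->
  (forall w, a * sqnorm w <= energy u [set: 'I_n] w) -> (m <= n)%N.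
Proof.
move=> a0 lower; rewrite leqNgt; apply/negP => nm.
pose A : 'M[R[i]]_(m, n) := \matrix_(j, i) (u i ^t* ) j 0.
have : kermx A != 0.
  by rewrite kermx_eq0 /row_free neq_ltn (leq_ltn_trans (rank_leq_col A)).
move=> /rowV0Pn[w /sub_kermxP wA w0].
have := energy_gt0 a0 lower w0; rewrite /energy big1 ?ltxx // => i _.
have -> : '[w, u i] = (w *m A) 0 i.
  by rewrite dotmxE !mxE; apply: eq_bigr => j _; rewrite [A _ _]mxE.
by rewrite wA mxE /normsq /= expr0n addr0.
Qed.

Section Bounds.
Variables (k1 k2 k3 : R).
Hypotheses (k1_gt0 : 0 < k1) (k2_gt0 : 0 < k2) (k3_gt0 : 0 < k3).
Hypotheses (m_gt0 : (0 < m)%N) (n_gt0 : (0 < n)%N).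
Hypothesis u_le : forall i, l2norm (u i) ^+ 2 <= (k1 * (m%:R / n%:R))%:C.
Hypothesis u_frame : frame_bounds u [set: 'I_n] k2 k3.

Let mR : 0 < m%:R :> R. Proof. by rewrite ltr0n. Qed.
Let nR : 0 < n%:R :> R. Proof. by rewrite ltr0n. Qed.

Lemma subframe_large : 47 * (k1 / k2) <= n%:R / m%:R ->
  has_small_subframe u (1642 * (k1 / k2)) ((2 + Num.sqrt 2) ^+ 2 * k1)
    (1642 * (k1 * k3 / k2)).
Proof.
move=> nm; pose eps := k1 * (m%:R / n%:R).
have eps0 : 0 < eps by rewrite mulr_gt0 ?divr_gt0.
pose x := k2 / eps.
have x0 : 0 < x by rewrite divr_gt0.
have epsx : eps * x = k2 by rewrite mulrC divfK ?gt_eqF.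
have x47 : 47 <= x.
  rewrite /x /eps ler_pdivlMr // mulrA.
  have := ler_wpM2r (ltW (divr_gt0 mR nR)) (ler_wpM2l (ltW k2_gt0) nm).
  have -> : k2 * (n%:R / m%:R) * (m%:R / n%:R) = k2 by field; rewrite !gt_eqF.
  by have -> : k2 * (47 * (k1 / k2)) * (m%:R / n%:R) = 47 * k1 * (m%:R / n%:R)
    by field; rewrite !gt_eqF.
have norm_le i : sqnorm (u i) <= eps by have := u_le i; rewrite sqr_l2norm lecR.
have /frame_boundsP HJ := u_frame.
pose v := Num.sqrt x.
have v2 : v ^+ 2 = x by rewrite sqr_sqrtr // ltW.
have v0 : 0 < v by rewrite sqrtr_gt0.
have [s2 s_gt s_lt] := sqrt2_bounds R.
(* Here (2 + sqrt 2)^2 = 6 + 4 sqrt 2 is less than 47. *)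
have v_ge : 2 + Num.sqrt 2 <= v.
  rewrite -(ler_pXn2r (n := 2)) ?nnegrE ?v2 ?(ltW v0) //; lra.
(* Both [u] and [y] start at [v]; [kappa] and [nu] are scaled to give the initial upper bound [k3]
   and cardinality [n]. *)
have [|||||S cardS HS] := @iterated_halving R m n u eps eps0 norm_le (k3 / x) (n%:R / x)
  [set: 'I_n] v v _ _ v_ge v0.
- by rewrite divr_gt0.
- by rewrite divr_gt0.
- have : 0 <= v * (26 / 5 + 7) by rewrite mulr_ge0 ?ltW //; lra.
  lra.
- by rewrite v2 divfK ?gt_eqF // cardsT card_ord.
- by move=> w; rewrite v2 epsx divfK ?gt_eqF.
exists S; split.
  by apply: le_trans cardS _; rewrite le_eqVlt; apply/orP; left; apply/eqP;
    rewrite /x /eps; field; rewrite !gt_eqF.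
apply/frame_boundsP => w; have := HS w.
have -> : eps * (2 + Num.sqrt 2) ^+ 2 = (2 + Num.sqrt 2) ^+ 2 * k1 * (m%:R / n%:R).
  by rewrite /eps; ring.
suff -> : k3 / x * 1642 = 1642 * (k1 * k3 / k2) * (m%:R / n%:R) by [].
by rewrite /x /eps; field; rewrite !gt_eqF.
Qed.

(** The whole frame serves: the factor m/n is at most 1, and 47 (k1 / k2) (m/n) exceeds 1. *)
Lemma subframe_small : 1 <= n%:R / m%:R :> R -> n%:R / m%:R < 47 * (k1 / k2) ->
  has_small_subframe u (47 * (k1 / k2)) k2 (47 * (k1 * k3 / k2)).
Proof.
move=> nm1 nm2; exists [set: 'I_n]; split.
  by rewrite cardsT card_ord -ler_pdivrMr // ltW.
move: nm1; rewrite ler_pdivlMr // mul1r => mn.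
have /frame_boundsP HJ := u_frame; apply/frame_boundsP => w.
have /andP[H1 H2] := HJ w; apply/andP; split.
  apply: le_trans H1; rewrite ler_wpM2r ?sqnorm_ge0 //.
  by rewrite ler_piMr ?(ltW k2_gt0) // ler_pdivrMr // mul1r.
apply: le_trans H2 _; rewrite ler_wpM2r ?sqnorm_ge0 //.
have -> : 47 * (k1 * k3 / k2) * (m%:R / n%:R) = k3 * ((47 * (k1 / k2)) * (m%:R / n%:R)).
  by field; rewrite !gt_eqF.
rewrite ler_peMr ?(ltW k3_gt0) //.
move: nm2; rewrite ltr_pdivrMr // => nm2.
by rewrite [leRHS]mulrA ler_pdivlMr // mul1r ltW.
Qed.

Lemma subframe_exists : has_small_subframe u (1642 * (k1 / k2))
  (Num.min ((2 + Num.sqrt 2) ^+ 2 * k1) k2) (1642 * (k1 * k3 / k2)).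
Proof.
have k12 : 0 <= k1 / k2 by rewrite divr_ge0 ?ltW.
have k132 : 0 <= k1 * k3 / k2 by rewrite divr_ge0 ?mulr_ge0 ?ltW.
have [nm|nm] := leP (47 * (k1 / k2)) (n%:R / m%:R).
  by apply: has_small_subframe_weaken (subframe_large nm); rewrite ?ge_min ?lexx.
have mn : 1 <= n%:R / m%:R :> R.
  rewrite ler_pdivlMr // mul1r ler_nat (frame_dim_le k2_gt0) // => w.
  by have /frame_boundsP/(_ w)/andP[] := u_frame.
apply: has_small_subframe_weaken (subframe_small mn nm).
- by rewrite ler_wpM2r // ler_nat.
- by rewrite ge_min lexx orbT.
- by rewrite ler_wpM2r // ler_nat.
Qed.

End Bounds.
End Subframes.

Theorem theorem2p3 (R : realType) (k1 k2 k3 : R)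
    (k1_gt0 : 0 < k1) (k2_gt0 : 0 < k2) (k3_gt0 : 0 < k3) :
  (exists c1 c2 c3 : R,
    [/\ 0 < c1, 0 < c2, 0 < c3 &
      forall (m n : nat) (u : 'I_n -> 'rV[R[i]]_m),
        (1 <= m)%N -> (1 <= n)%N ->
        (forall i, l2norm (u i) ^+ 2 <= (k1 * (m%:R / n%:R))%:C) ->
        frame_bounds u [set: 'I_n] k2 k3 ->
        has_small_subframe u c1 c2 c3]) /\
  (forall (m n : nat) (u : 'I_n -> 'rV[R[i]]_m),
    (1 <= m)%N -> (1 <= n)%N ->
    (forall i, l2norm (u i) ^+ 2 <= (k1 * (m%:R / n%:R))%:C) ->
    frame_bounds u [set: 'I_n] k2 k3 ->
    (47 * (k1 / k2) <= n%:R / m%:R ->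
      has_small_subframe u (1642 * (k1 / k2)) ((2 + Num.sqrt 2) ^+ 2 * k1)
        (1642 * (k1 * k3 / k2))) /\
    (1 <= (n%:R / m%:R : R) < 47 * (k1 / k2) ->
      has_small_subframe u (47 * (k1 / k2)) k2 (47 * (k1 * k3 / k2)))).
Proof.
have s_gt0 : 0 < (2 + Num.sqrt 2) ^+ 2 :> R by rewrite exprn_gt0 // ltr_wpDr ?sqrtr_ge0.
split.
  exists (1642 * (k1 / k2)), (Num.min ((2 + Num.sqrt 2) ^+ 2 * k1) k2),
    (1642 * (k1 * k3 / k2)).
  split=> [|||m n u m0 n0 u_le u_frame].
  - by rewrite mulr_gt0 // divr_gt0.
  - by rewrite lt_min mulr_gt0.
  - by rewrite mulr_gt0 // divr_gt0 // mulr_gt0.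
  - exact: subframe_exists.
move=> m n u m0 n0 u_le u_frame; split=> [|/andP[]].
  exact: subframe_large.
exact: subframe_small.
Qed.
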